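(* The area generating function $PA^{(2)}(q)=\sum_{n\ge1}PA^{(2)}_nq^n$ of 2-sided prudent polygons (where $PA^{(2)}_n$ is the number of 2-sided prudent polygons of area $n$) is $$PA^{(2)}(q)=\frac{2q}{1-2q}+\frac{2q}{1-q},$$ and so the number of such polygons is $PA^{(2)}_n=2^n+2$ for $n\ge1$.
   Context: All walks are on the square lattice $\mathbb{Z}^2$, start at $(0,0)$ and take unit steps north, south, east, west. A walk $\omega$ is prudent if it is self-avoiding and never takes a step towards an already occupied site: if a step goes from $p$ to $p+d$ (with $d$ a unit direction vector), then none of the points $p+kd$, $k\ge1$, has been visited before that step. Let $\omega_i$ be the walk formed by the first $i$ steps and $b_i$ its bounding box (the smallest, possibly degenerate, lattice rectangle containing $\omega_i$). A prudent walk $\omega$ of length $N$ is 2-sided if for each $i=0,1,\dots,N$ the walk $\omega_i$ ends on the north or east side of $b_i$. A prudent polygon is a prudent walk, with more than one step, that ends at a lattice site adjacent to its starting point $(0,0)$; the polygon is the closed curve obtained by adding the edge joining the endpoint to $(0,0)$. Polygons are counted as walks, i.e. they are rooted at $(0,0)$ and oriented. The polygon is 2-sided if the underlying prudent walk is 2-sided. Its area is the number of unit cells enclosed. *)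

(* Defs.v *)
From HB Require Import structures.
From mathcomp Require Import all_boot all_order all_algebra.
From mathcomp Require Import finmap.
From mathcomp Require Import all_classical.

Set Implicit Arguments.
Unset Strict Implicit.
Unset Printing Implicit Defensive.

Import Order.TTheory GRing.Theory Num.Theory.

Local Open Scope classical_set_scope.
Local Open Scope ring_scope.

Definition Z2 : Type := (int * int)%type.

Definition e1 : Z2 := (1, 0).
Definition e2 : Z2 := (0, 1).

Definition adjacent (p r : Z2) : bool :=
  r - p \in [:: e1; - e1; e2; - e2].

(* A walk w is the list of the sites reached after each step; the starting    *)
(* site (0, 0) is not listed, so the length of the walk is size w and its     *)
(* first i steps form the walk take i w.                                      *)
Definition is_walk (w : seq Z2) : bool := path adjacent 0 w.

Definition sites (w : seq Z2) : seq Z2 := 0 :: w.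

Definition endpoint (w : seq Z2) : Z2 := last 0 w.

Definition site (w : seq Z2) (i : nat) : Z2 := nth 0 (sites w) i.

Definition self_avoiding (w : seq Z2) : bool := uniq (sites w).

Definition prudent (w : seq Z2) : Prop :=
  [/\ is_walk w, self_avoiding w &
    forall i, (i < size w)%N -> forall k, (1 <= k)%N ->
      site w i + (site w i.+1 - site w i) *+ k \notin sites (take i w)].

Record rect := Rect { west : int; east : int; south : int; north : int }.

(* The default value 0 of the iterated extrema is harmless: the origin        *)
(* belongs to every walk.                                                     *)
Definition bounding_box (w : seq Z2) : rect :=
  {| west  := \big[Num.min/0]_(p <- sites w) p.1;
     east  := \big[Num.max/0]_(p <- sites w) p.1;
     south := \big[Num.min/0]_(p <- sites w) p.2;
     north := \big[Num.max/0]_(p <- sites w) p.2 |}.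

Definition on_north_side (b : rect) (p : Z2) : bool :=
  (p.2 == north b) && (west b <= p.1 <= east b).

Definition on_east_side (b : rect) (p : Z2) : bool :=
  (p.1 == east b) && (south b <= p.2 <= north b).

Definition two_sided (w : seq Z2) : Prop :=
  forall i, (i <= size w)%N ->
    let b := bounding_box (take i w) in
    let p := endpoint (take i w) in
    on_north_side b p || on_east_side b p.

Definition prudent_polygon (w : seq Z2) : Prop :=
  [/\ prudent w, (1 < size w)%N & adjacent (endpoint w) 0].

Definition two_sided_prudent_polygon (w : seq Z2) : Prop :=
  prudent_polygon w /\ two_sided w.

(* The pairs of consecutive sites in cyclic order, including the closing edge *)
(* from the endpoint to the origin.                                           *)
Definition oriented_edges (w : seq Z2) : seq (Z2 * Z2) :=
  zip (sites w) (rot 1 (sites w)).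

Definition is_edge (w : seq Z2) (p r : Z2) : bool :=
  ((p, r) \in oriented_edges w) || ((r, p) \in oriented_edges w).

(* The unit cell [x, x + 1] x [y, y + 1] is represented by its lower left     *)
(* corner c = (x, y).  One passes from a cell to one of its four neighbours   *)
(* when their common side is not an edge of the polygon.                      *)
Definition pass (w : seq Z2) (c d : Z2) : bool :=
  [|| (d == c + e1) && ~~ is_edge w (c + e1) (c + e1 + e2),
      (d == c + e2) && ~~ is_edge w (c + e2) (c + e1 + e2),
      (d == c - e1) && ~~ is_edge w c (c + e2)
    | (d == c - e2) && ~~ is_edge w c (c + e1)].

(* A cell is enclosed when it lies in a bounded component of the complement   *)
(* of the closed curve.                                                       *)
Definition enclosed (w : seq Z2) (c : Z2) : Prop :=
  exists M : int, forall cs : seq Z2, path (pass w) c cs ->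
    `|(last c cs).1| <= M /\ `|(last c cs).2| <= M.

(* The number of elements of A if A is finite, and 0 otherwise.               *)
Definition set_card (T : choiceType) (A : set T) : nat := #|` fset_set A|.

Definition area (w : seq Z2) : nat := set_card [set c | enclosed w c].

Definition PA2 (n : nat) : nat :=
  set_card [set w | two_sided_prudent_polygon w /\ area w = n].

(* Formal power series: sequences of coefficients with the Cauchy product.    *)
Definition fps (R : Type) : Type := nat -> R.

HB.instance Definition _ (R : Type) := gen_eqMixin (fps R).
HB.instance Definition _ (R : Type) := gen_choiceMixin (fps R).

Section FpsZmod.
Variable R : zmodType.

Definition fps_zero : fps R := fun=> 0.
Definition fps_opp (f : fps R) : fps R := fun n => - f n.
Definition fps_add (f g : fps R) : fps R := fun n => f n + g n.

Lemma fps_addA : associative fps_add.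
Proof. by move=> f g h; apply/funext => n; exact: addrA. Qed.

Lemma fps_addC : commutative fps_add.
Proof. by move=> f g; apply/funext => n; exact: addrC. Qed.

Lemma fps_add0 : left_id fps_zero fps_add.
Proof. by move=> f; apply/funext => n; exact: add0r. Qed.

Lemma fps_addN : left_inverse fps_zero fps_opp fps_add.
Proof. by move=> f; apply/funext => n; exact: addNr. Qed.

HB.instance Definition _ := GRing.isZmodule.Build (fps R)
  fps_addA fps_addC fps_add0 fps_addN.

End FpsZmod.

Section FpsComRing.
Variable R : comNzRingType.
Implicit Types f g h : fps R.

Definition fps_one : fps R := fun n => (n == 0)%:R.

Definition fps_mul f g : fps R := fun n => \sum_(i < n.+1) f i * g (n - i)%N.

Definition fps_trunc (n : nat) f : {poly R} := \poly_(i < n.+1) f i.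

Lemma fps_mul_trunc n m f g : (m <= n)%N ->
  fps_mul f g m = (fps_trunc n f * fps_trunc n g)`_m.
Proof.
move=> le_mn; rewrite coefM; apply: eq_bigr => i _; rewrite !coef_poly.
have lt_in : (i < n.+1)%N by rewrite (leq_trans (ltn_ord i)).
by rewrite lt_in (leq_ltn_trans (leq_subr i m)).
Qed.

Lemma fps_mulC : commutative fps_mul.
Proof.
by move=> f g; apply/funext => n; rewrite !(@fps_mul_trunc n n) // mulrC.
Qed.

Lemma fps_mulA : associative fps_mul.
Proof.
move=> f g h; apply/funext => n.
have aux f' g' h' : fps_mul f' (fps_mul g' h') n =
    (fps_trunc n f' * (fps_trunc n g' * fps_trunc n h'))`_n.
  rewrite coefM; apply: eq_bigr => i _.
  rewrite coef_poly ltn_ord; congr (_ * _).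
  by rewrite (@fps_mul_trunc n) ?leq_subr.
by rewrite aux (fps_mulC (fps_mul f g)) aux mulrA [in RHS]mulrC.
Qed.

Lemma fps_mul1 : left_id fps_one fps_mul.
Proof.
move=> f; apply/funext => n; rewrite /fps_mul big_ord_recl /fps_one /= mul1r subn0.
by rewrite big1 ?addr0 // => i _; rewrite mul0r.
Qed.

Lemma fps_mulDl : left_distributive fps_mul +%R.
Proof.
move=> f g h; apply/funext => n.
change (fps_mul (f + g) h n = fps_mul f h n + fps_mul g h n).
by rewrite /fps_mul -big_split; apply: eq_bigr => i _; exact: mulrDl.
Qed.

Lemma fps_one_neq0 : fps_one != 0.
Proof.
apply/eqP => /(congr1 (fun f : fps R => f 0)) /eqP.
by rewrite /fps_one eqxx oner_eq0.
Qed.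

HB.instance Definition _ := GRing.Zmodule_isComNzRing.Build (fps R)
  fps_mulA fps_mulC fps_mul1 fps_mulDl fps_one_neq0.

Definition fpsX : fps R := fun n => (n == 1)%:R.

End FpsComRing.

Section FpsUnitRing.
Variable R : comUnitRingType.
Implicit Types f g : fps R.

Definition fps_unit : pred (fps R) := [pred f : fps R | f 0 \is a GRing.unit].

(* The first n coefficients of the inverse of f, from                         *)
(* f 0 * g n = - \sum_(i < n) f (n - i) * g i.                                *)
Fixpoint fps_inv_seq f (n : nat) : seq R :=
  if n is m.+1 then
    let s := fps_inv_seq f m in
    rcons s ((f 0)^-1 * ((m == 0)%:R - \sum_(i < m) f (m - i)%N * s`_i))
  else [::].

(* As required of the inverse in a unitRingType, noninvertible series are     *)
(* left unchanged.                                                            *)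
Definition fps_inv f : fps R :=
  if fps_unit f then fun n => (fps_inv_seq f n.+1)`_n else f.

Lemma size_fps_inv_seq f n : size (fps_inv_seq f n) = n.
Proof. by elim: n => //= n IHn; rewrite size_rcons IHn. Qed.

Lemma nth_fps_inv_seq f n i : (i < n)%N ->
  (fps_inv_seq f n)`_i = (fps_inv_seq f i.+1)`_i.
Proof.
elim: n => // n IHn; rewrite ltnS leq_eqVlt => /predU1P[-> //|lt_in].
by rewrite [LHS]nth_rcons size_fps_inv_seq lt_in IHn.
Qed.

Lemma fps_mulV : {in fps_unit, left_inverse 1 fps_inv *%R}.
Proof.
move=> f Uf; have {}Uf : fps_unit f by exact: Uf.
apply/funext => n; change (fps_mul (fps_inv f) f n = fps_one R n).
rewrite /fps_inv Uf /fps_mul big_ord_recr /= subnn.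
rewrite nth_rcons size_fps_inv_seq ltnn eqxx [X in _ + X]mulrC mulVKr //.
rewrite addrC -addrA -[RHS]addr0; congr (_ + _); apply/eqP.
rewrite addrC subr_eq0; apply/eqP; apply: eq_bigr => i _.
by rewrite mulrC [in RHS]nth_fps_inv_seq.
Qed.

Lemma fps_unitP f g : g * f = 1 -> fps_unit f.
Proof.
move=> /(congr1 (fun h : fps R => h 0)) gf1; rewrite /fps_unit inE.
apply/unitrPr; exists (g 0).
have {gf1} : fps_mul g f 0 = fps_one R 0 by exact: gf1.
by rewrite /fps_mul big_ord1 /fps_one mulrC.
Qed.

Lemma fps_inv_out : {in [predC fps_unit], fps_inv =1 id}.
Proof. by move=> f; rewrite inE /fps_inv => /negbTE nUf; rewrite [fps_unit f]nUf. Qed.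

HB.instance Definition _ := GRing.ComNzRing_hasMulInverse.Build (fps R)
  fps_mulV fps_unitP fps_inv_out.

End FpsUnitRing.

(* The sum over n >= 1 of PA2 n * q ^ n.                                      *)
Definition area_gf : fps rat := fun n => if (1 <= n)%N then (PA2 n)%:R else 0.

(* Main.v *)
Require Import Defs.
From HB Require Import structures.
From mathcomp Require Import all_boot all_order all_algebra.
From mathcomp Require Import finmap.
From mathcomp Require Import all_classical.
From mathcomp Require Import zify.

Set Implicit Arguments.
Unset Strict Implicit.
Unset Printing Implicit Defensive.

Import Order.TTheory GRing.Theory Num.Theory.

Local Open Scope ring_scope.

(* A 2-sided prudent polygon ends at (1, 0) or at (0, 1), and reflection in    *)
(* the diagonal exchanges the two cases. A polygon ending at (1, 0) may go     *)
(* S^b E N^b and enclose a column of b cells. Otherwise it starts north or     *)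
(* west and stays in the half-plane x <= 0, where it can never step south; it  *)
(* moves horizontally in each row and climbs until it steps to the column      *)
(* x = 1, which it has to descend down to (1, 0). It then encloses a stack of  *)
(* left-pointing rows of arbitrary positive lengths, that is, a composition of *)
(* the area n. There are 2^(n-1) compositions, hence 2 (2^(n-1) + 1) polygons. *)

(** The walk is followed one step at a time. A new site must be topmost or rightmost among the sites
    visited so far, so it cannot lie strictly below one visited site and strictly west of another
    ([ne_extreme2]). This obstruction and the free rays of prudence leave, for walks ending at (1,
    0), only the families [column_walk] and [row_walk] ([ne_prudent_classify], resting on
    [south_column] and [up_rows]), and all their members with nonzero parameter are polygons. No
    walk of more than one step ends at (-1, 0) ([ne_prudent_last_west]); reflection then excludes
    (0, -1) and exchanges (1, 0) with (0, 1).

    Areas are found by exhibiting the interior as a region with one interval of cells per row, whose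
    boundary is exactly the edge set of the polygon. No path of cells crosses this boundary, and a
    cell outside escapes to infinity along its own row ([enclosed_in_rows]). Hence [row_walk ks] has
    area [total ks]; since [row_walk] is injective, counting compositions gives the coefficients,
    and the generating function is compared coefficientwise. *)

Definition free_ray (s : seq Z2) (p d : Z2) : Prop :=
  forall k, (0 < k)%N -> p + d *+ k \notin s.

Definition ne_extreme (s : seq Z2) (p : Z2) : bool :=
  all (fun r : Z2 => r.2 <= p.2) s || all (fun r : Z2 => r.1 <= p.1) s.

(* The remaining steps v of a 2-sided prudent walk that is at p after having   *)
(* visited the sites s.                                                        *)
Fixpoint ne_prudent (s : seq Z2) (p : Z2) (v : seq Z2) : Prop :=
  if v is p' :: v' then
    [/\ adjacent p p', free_ray s p (p' - p), ne_extreme s p'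
      & ne_prudent (p' :: s) p' v']
  else True.

Lemma pairD (a b c d : int) : (a, b) + (c, d) = (a + c, b + d) :> Z2.
Proof. by []. Qed.

Lemma pairN (a b : int) : - ((a, b) : Z2) = (- a, - b).
Proof. by []. Qed.

Lemma pairMn (a b : int) k : ((a, b) : Z2) *+ k = (a *+ k, b *+ k).
Proof. by elim: k => [|k IH] //; rewrite !mulrSr IH pairD. Qed.

(** Here [catrev (take i v) s] collects the sites visited after [i] further steps; this links the
    recursion to the indexed definitions. *)
Lemma ne_prudent_nth s p v : ne_prudent s p v <->
  forall i, (i < size v)%N ->
    [/\ adjacent (nth 0 (p :: v) i) (nth 0 v i),
        free_ray (catrev (take i v) s) (nth 0 (p :: v) i)
          (nth 0 v i - nth 0 (p :: v) i)
      & ne_extreme (catrev (take i v) s) (nth 0 v i)].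
Proof.
elim: v s p => [|q v IH] s p /=; first by split.
split=> [[pq fr ne /IH okv] [|i] lt_i //|H].
  exact: (okv i).
have [pq fr ne] := H 0%N isT; split=> //; apply/IH => i lt_i.
exact: (H i.+1).
Qed.

Lemma ne_extreme_mem s s' p : s =i s' -> ne_extreme s p = ne_extreme s' p.
Proof. by move=> e; congr (_ || _); apply: eq_all_r. Qed.

Lemma bigmax_sites (f : Z2 -> int) (w : seq Z2) m :
  f 0 = 0 -> (\big[Num.max/0]_(p <- sites w) f p <= m) = all (fun p => f p <= m) (sites w).
Proof.
move=> f0; have aux s : (\big[Num.max/0]_(p <- s) f p <= m) = (0 <= m) && all (fun p => f p <= m) s.
  elim: s => [|p s IH]; first by rewrite big_nil andbT.
  by rewrite big_cons ge_max IH /= andbCA.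
by rewrite aux /= f0 andbA andbb.
Qed.

Lemma bigmin_sites (f : Z2 -> int) (w : seq Z2) m :
  f 0 = 0 -> (m <= \big[Num.min/0]_(p <- sites w) f p) = all (fun p => m <= f p) (sites w).
Proof.
move=> f0; have aux s : (m <= \big[Num.min/0]_(p <- s) f p) = (m <= 0) && all (fun p => m <= f p) s.
  elim: s => [|p s IH]; first by rewrite big_nil andbT.
  by rewrite big_cons le_min IH /= andbCA.
by rewrite aux /= f0 andbA andbb.
Qed.

Lemma bounding_box_sites w p : p \in sites w ->
  (west (bounding_box w) <= p.1 <= east (bounding_box w)) &&
  (south (bounding_box w) <= p.2 <= north (bounding_box w)).
Proof.
move=> pw; rewrite /bounding_box /=.
have /allP -> // : all (fun p => \big[Num.min/0]_(p <- sites w) p.1 <= p.1) (sites w).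
  by rewrite -bigmin_sites.
have /allP -> // : all (fun p => p.1 <= \big[Num.max/0]_(p <- sites w) p.1) (sites w).
  by rewrite -bigmax_sites.
have /allP -> // : all (fun p => \big[Num.min/0]_(p <- sites w) p.2 <= p.2) (sites w).
  by rewrite -bigmin_sites.
have /allP -> // : all (fun p => p.2 <= \big[Num.max/0]_(p <- sites w) p.2) (sites w).
by rewrite -bigmax_sites.
Qed.

(** The endpoint lies in the bounding box, so being on a side only requires one inequality with the
    maximum, which unfolds to a comparison with every site. *)
Lemma on_side_extreme w :
  on_north_side (bounding_box w) (endpoint w) ||
  on_east_side (bounding_box w) (endpoint w) = ne_extreme (sites w) (endpoint w).
Proof.
have /bounding_box_sites/andP[b1 b2] : endpoint w \in sites w by exact: mem_last.
rewrite /on_north_side /on_east_side b1 b2 !andbT.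
have /andP[_ b1'] := b1; have /andP[_ b2'] := b2.
by rewrite !eq_le b1' b2' !andTb /bounding_box /= !bigmax_sites.
Qed.

Lemma ne_extreme_cons s p : ne_extreme (p :: s) p = ne_extreme s p.
Proof. by rewrite /ne_extreme /= !lexx. Qed.

Lemma take_site w i : (i < size w)%N -> sites (take i.+1 w) =i site w i.+1 :: sites (take i w).
Proof.
move=> lt_i r; rewrite (take_nth 0 lt_i) /sites -rcons_cons mem_rcons //.
Qed.

Lemma uniq_walk w : (forall i, (i < size w)%N -> nth 0 w i \notin sites (take i w)) ->
  uniq (sites w).
Proof.
move=> H; rewrite -(take_size w); elim: {-2}(size w) (leqnn (size w)) => [|n IH] le_n.
  by rewrite take0.
rewrite (take_nth 0 le_n) /sites -rcons_cons rcons_uniq H // IH //; exact: ltnW.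
Qed.

(** Self-avoidance is the case [k = 1] of the free rays, and a walk of length 0 is trivially on a
    side. *)
Lemma ne_prudentP w : prudent w /\ two_sided w <-> ne_prudent [:: 0] 0 w.
Proof.
have catE i r : (r \in catrev (take i w) [:: 0]) = (r \in sites (take i w)).
  by rewrite catrevE mem_cat mem_rev !inE orbC.
have endE i : (i < size w)%N -> endpoint (take i.+1 w) = nth 0 w i.
  by move=> lt_i; rewrite (take_nth 0 lt_i) /endpoint last_rcons.
split=> [[[/(pathP 0) Hw _ Hp] Ht]|].
  apply/ne_prudent_nth => i lt_i; split.
  - exact: Hw.
  - by move=> k k0; rewrite catE; have := Hp i lt_i k k0.
  - have /= := Ht i.+1 lt_i; rewrite on_side_extreme endE //.
    rewrite (ne_extreme_mem _ (take_site lt_i)) ne_extreme_cons.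
    by rewrite (ne_extreme_mem _ (catE i)).
move/ne_prudent_nth => H; split.
  split.
  - by apply/(pathP 0) => i lt_i; have [] := H i lt_i.
  - apply: uniq_walk => i lt_i; have [_ fr _] := H i lt_i.
    by have := fr 1%N isT; rewrite mulr1n addrC subrK catE.
  - by move=> i lt_i k k0; have [_ fr _] := H i lt_i; have := fr k k0; rewrite catE.
move=> [_ | i lt_i] /=; rewrite on_side_extreme.
  by rewrite take0.
have [_ _] := H i lt_i.
by rewrite endE // (ne_extreme_mem _ (take_site lt_i)) ne_extreme_cons (ne_extreme_mem _ (catE i)).
Qed.

Lemma ne_prudent_cat s p u v : ne_prudent s p (u ++ v) <->
  ne_prudent s p u /\ ne_prudent (catrev u s) (last p u) v.
Proof.
elim: u s p => [|q u IH] s p /=; first by split=> // -[].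
by split=> [[? ? ? /IH[]]|[[? ? ? ?] ?]]; [|split=> //; apply/IH].
Qed.

Lemma ne_prudent_mem_notin s p v r : ne_prudent s p v -> r \in s -> r \notin v.
Proof.
elim: v s p => [|q v IH] s p //= [_ fr _ okv] rs; rewrite inE negb_or.
rewrite (IH _ _ okv) ?inE ?rs ?orbT // andbT.
by apply: contraTneq rs => ->; have := fr 1%N isT; rewrite mulr1n addrC subrK.
Qed.

Lemma ne_prudent_extreme s p v q : ne_prudent s p v -> q \in v -> ne_extreme s q.
Proof.
elim: v s p => [|r v IH] s p //= [_ _ ne okv]; rewrite inE => /predU1P[->//|qv].
have /orP[] /= := IH _ _ okv qv => /andP[_ a]; first by rewrite /ne_extreme a.
by rewrite /ne_extreme a orbT.
Qed.

(** The four directions of a step, with the free ray stated by coordinates so that it can be applied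
    to any visited site ahead. *)
Variant step_spec (s : seq Z2) (x y : int) : Z2 -> Prop :=
| StepE of (forall x', x < x' -> (x', y) \notin s) & ne_extreme s (x + 1, y) :
    step_spec s x y (x + 1, y)
| StepW of (forall x', x' < x -> (x', y) \notin s) & ne_extreme s (x - 1, y) :
    step_spec s x y (x - 1, y)
| StepN of (forall y', y < y' -> (x, y') \notin s) & ne_extreme s (x, y + 1) :
    step_spec s x y (x, y + 1)
| StepS of (forall y', y' < y -> (x, y') \notin s) & ne_extreme s (x, y - 1) :
    step_spec s x y (x, y - 1).

Lemma ne_prudent_consP s x y q v : ne_prudent s (x, y) (q :: v) ->
  step_spec s x y q /\ ne_prudent (q :: s) q v.
Proof.
case: q => a b /= [adj fr ne okv]; split=> //.
move: adj; rewrite /adjacent !inE => /or4P[] /eqP e; rewrite e in fr.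
all: move: e; rewrite /e1 /e2 ?pairN pairD => -[ea eb].
- have {}ea : a = x + 1 by lia.
  have {}eb : b = y by lia.
  subst a b; constructor=> // x' lt_x.
  have ->: (x', y) = (x, y) + e1 *+ `|x' - x|%N by rewrite pairMn pairD; congr pair; lia.
  by apply: fr; lia.
- have {}ea : a = x - 1 by lia.
  have {}eb : b = y by lia.
  subst a b; constructor=> // x' lt_x.
  have ->: (x', y) = (x, y) + (- e1) *+ `|x' - x|%N.
    by rewrite pairN pairMn pairD; congr pair; lia.
  by apply: fr; lia.
- have {}ea : a = x by lia.
  have {}eb : b = y + 1 by lia.
  subst a b; constructor=> // y' lt_y.
  have ->: (x, y') = (x, y) + e2 *+ `|y' - y|%N by rewrite pairMn pairD; congr pair; lia.
  by apply: fr; lia.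
- have {}ea : a = x by lia.
  have {}eb : b = y - 1 by lia.
  subst a b; constructor=> // y' lt_y.
  have ->: (x, y') = (x, y) + (- e2) *+ `|y' - y|%N.
    by rewrite pairN pairMn pairD; congr pair; lia.
  by apply: fr; lia.
Qed.

(** * Straight runs and the two families of walks *)

Fixpoint run (d : Z2) (n : nat) (p : Z2) : seq Z2 :=
  if n is m.+1 then (p + d) :: run d m (p + d) else [::].

Lemma runS d n p : run d n.+1 p = (p + d) :: run d n (p + d).
Proof. by []. Qed.

(** Runs in either direction from column [x] to column [t]; the starting site is not listed, as in
    walks. *)
Definition hrun (x t y : int) : seq Z2 :=
  run (if x <= t then e1 else - e1) `|t - x| (x, y).

(* The continuation, from the site (x, y), of a walk enclosing rows with       *)
(* cells - k, ..., 0 for each k in ks, the lowest of them being row y; it ends *)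
(* by the descent of the column x = 1 down to (1, 0).                          *)
Fixpoint rows_from (x : int) (y : nat) (ks : seq nat) : seq Z2 :=
  if ks is k :: ks' then
    hrun x (- k%:Z) y ++ (- k%:Z, y.+1%:Z) :: rows_from (- k%:Z) y.+1 ks'
  else hrun x 1 y ++ run (- e2) y (1, y%:Z).

Definition row_walk (ks : seq nat) : seq Z2 := rows_from 0 0 ks.

Definition column_walk (b : nat) : seq Z2 :=
  run (- e2) b 0 ++ (1, - b%:Z) :: run e2 b (1, - b%:Z).

Lemma rows_from_nil x y : rows_from x y [::] = hrun x 1 y ++ run (- e2) y (1, y%:Z).
Proof. by []. Qed.

Lemma rows_from_cons x y k ks : rows_from x y (k :: ks) =
  hrun x (- k%:Z) y ++ (- k%:Z, y.+1%:Z) :: rows_from (- k%:Z) y.+1 ks.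
Proof. by []. Qed.

Lemma hrunxx (x y : int) : hrun x x y = [::].
Proof. by rewrite /hrun subrr. Qed.

Lemma hrun_lt (x t y : int) : x < t -> hrun x t y = (x + 1, y) :: hrun (x + 1) t y.
Proof.
move=> lt_xt; rewrite /hrun (ltW lt_xt).
have -> : (x + 1 <= t) = true by lia.
have -> : absz (t - x)%R = (absz (t - (x + 1))%R).+1 by lia.
by rewrite /= pairD addr0.
Qed.

Lemma hrun_gt (x t y : int) : t < x -> hrun x t y = (x - 1, y) :: hrun (x - 1) t y.
Proof.
move=> lt_tx; rewrite /hrun leNgt lt_tx /=.
have -> : absz (t - x)%R = (absz (t - (x - 1))%R).+1 by lia.
rewrite /= pairN pairD oppr0 addr0; case: (leP (x - 1) t) => // le_t.
by have -> : absz (t - (x - 1))%R = 0%N by lia.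
Qed.

(** * Obstructions to reaching (1, 0), and classification *)

Lemma ne_extreme2 s p a b : ne_extreme s p -> a \in s -> b \in s ->
  a.2 <= p.2 \/ b.1 <= p.1.
Proof. by case/orP => /allP H ha hb; [left; apply: H | right; apply: H]. Qed.

Lemma ne_prudent_last_notin s p v : ne_prudent s p v -> v != [::] -> last p v \notin s.
Proof.
case: v => // q v H _; apply/negP => /(ne_prudent_mem_notin H).
by rewrite /= mem_last.
Qed.

Lemma ne_prudent_last_extreme s p v a b : ne_prudent s p v -> last p v != p ->
  a \in s -> b \in s -> a.2 <= (last p v).2 \/ b.1 <= (last p v).1.
Proof.
case: v => [|q v] H; first by rewrite eqxx.
by move=> _; apply: ne_extreme2; apply: (ne_prudent_extreme H); rewrite /= mem_last.
Qed.

(** The site (1, 0) is both below and west of the visited site (x, y), hence no longer extreme. *)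
Lemma ne_prudent_last_ne s (x y : int) v : ne_prudent s (x, y) v -> (x, y) \in s ->
  0 < y -> 1 < x -> last (x, y) v != (1, 0).
Proof.
move=> H xs y0 x1; apply/eqP => e.
have ne : last (x, y) v != (x, y) by rewrite e; apply/eqP => -[]; lia.
by have := ne_prudent_last_extreme H ne xs xs; rewrite e => -[] /=; lia.
Qed.


(** The walk is on the top row, above a visited site of the column x = 1. Stepping south is not
    extreme west of that column, is blocked by (1, Y) on it, and east of it leaves a site that makes
    (1, 0) unreachable. *)
Lemma no_return_above s (x y Y : int) v : ne_prudent s (x, y) v -> (x, y) \in s ->
  (1, Y) \in s -> 0 < Y -> Y < y -> {in s, forall r : Z2, r.2 <= y} ->
  last (x, y) v != (1, 0).
Proof.
elim: v s x y => [|q v IH] s x y H xs Ys Y0 Yy le_y.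
  by apply/eqP => -[]; lia.
have [st H'] := ne_prudent_consP H; case: st H' => fr ne H' /=.
- apply: (IH _ _ _ H') => //; rewrite ?inE ?eqxx ?Ys ?orbT //.
  by move=> r /predU1P[-> //|/le_y].
- apply: (IH _ _ _ H') => //; rewrite ?inE ?eqxx ?Ys ?orbT //.
  by move=> r /predU1P[-> //|/le_y].
- apply: (IH _ _ _ H') => //; rewrite ?inE ?eqxx ?Ys ?orbT //; first by lia.
  by move=> r /predU1P[-> //|/le_y]; lia.
- have [/=|/= x1] := ne_extreme2 ne xs Ys; first by lia.
  have [x_eq|x_gt] : x = 1 \/ 1 < x by lia.
    by have := fr _ Yy; rewrite x_eq Ys.
  by apply: (ne_prudent_last_ne H'); rewrite ?inE ?eqxx //; lia.
Qed.

(** At height y > 0 the previous obstruction applies. At y <= 0 a step west is blocked by the origin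
    or fails to be extreme, so the walk never gets back to x = 1. *)
Lemma no_return_right s (x y : int) v : ne_prudent s (x, y) v -> (x, y) \in s ->
  (0, 0) \in s -> 1 < x -> last (x, y) v != (1, 0).
Proof.
elim: v s x y => [|q v IH] s x y H xs Os x1.
  by apply/eqP => -[]; lia.
have [y0|y0] : 0 < y \/ y <= 0 by lia.
  exact: (ne_prudent_last_ne H).
have [st H'] := ne_prudent_consP H; case: st H' => fr ne H' /=.
- by apply: (IH _ _ _ H'); rewrite ?inE ?eqxx ?Os ?orbT //; lia.
- have [yE|yn] : y = 0 \/ y < 0 by lia.
    by have := fr 0 ltac:(lia); rewrite yE Os.
  by have /= [] := ne_extreme2 ne Os xs; lia.
- by apply: (IH _ _ _ H'); rewrite ?inE ?eqxx ?Os ?orbT.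
- by apply: (IH _ _ _ H'); rewrite ?inE ?eqxx ?Os ?orbT.
Qed.

(** The visited site (1, t) blocks the way north, a step west is not extreme, and a step east leads
    to [no_return_right]; the walk can only sink further. *)
Lemma no_return_below s (t u : int) v : ne_prudent s (1, u) v -> (1, u) \in s ->
  (0, 0) \in s -> (1, t) \in s -> u < t -> t <= 0 ->
  last (1, u) v != (1, 0).
Proof.
elim: v s u => [|q v IH] s u H us Os ts ut t0.
  by apply/eqP => -[]; lia.
have [st H'] := ne_prudent_consP H; case: st H' => fr ne H' /=.
- by apply: (no_return_right H'); rewrite ?inE ?eqxx ?Os ?orbT.
- by have /= [] := ne_extreme2 ne Os us; lia.
- by have := fr _ ut; rewrite ts.
- by apply: (IH _ _ H'); rewrite ?inE ?eqxx ?Os ?ts ?orbT //; lia.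
Qed.

(** The descent is forced. A step east makes (1, 0) non-extreme because of (0, Y); a step west hits
    (0, Y) or is not extreme; a step north leads to [no_return_above] when z = Y and otherwise meets
    the site just left, which is what the implication on [z] records. *)
Lemma down_column s (z : nat) (Y : int) v : ne_prudent s (1, z%:Z) v ->
  (1, z%:Z) \in s -> (0, Y) \in s -> (0, 0) \in s -> 0 < Y -> z%:Z <= Y ->
  (z%:Z < Y -> (1, z%:Z + 1) \in s) -> {in s, forall r : Z2, r.2 <= Y} ->
  last (1, z%:Z) v = (1, 0) -> v = run (- e2) z (1, z%:Z).
Proof.
elim: v s z => [|q v IH] s z H zs Ys Os Y0 zY nxt leY lastE.
  by case: z lastE {H zs zY nxt} => // z [].
case: z H zs zY nxt lastE => [|z] H zs zY nxt lastE.
  by have := ne_prudent_last_notin H isT; rewrite lastE zs.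
have [st H'] := ne_prudent_consP H; case: st H' lastE {H} => fr ne H' /= lastE.
- have /= := ne_prudent_last_extreme H' _ _ _; rewrite lastE => /(_ (0, Y) (1 + 1, z.+1%:Z)).
  by rewrite !inE eqxx Ys orbT => /(_ isT isT isT) [] /=; lia.
- have [zE|zl] : z.+1%:Z = Y \/ z.+1%:Z < Y by lia.
    by have := fr 0 isT; rewrite zE Ys.
  by have /= [] := ne_extreme2 ne Ys zs; lia.
- have [zE|zl] : z.+1%:Z = Y \/ z.+1%:Z < Y by lia.
    move/eqP: lastE => lastE; exfalso; apply/negP: lastE.
    apply: (no_return_above H' (Y := Y)); rewrite ?inE ?eqxx -?zE ?zs ?orbT //; try lia.
    by move=> r /predU1P[-> //|/leY]; lia.
  by have := fr (z.+1%:Z + 1) ltac:(lia); rewrite nxt.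
- rewrite pairN pairD addr0.
  have zE : z.+1%:Z - 1 = z by lia.
  rewrite zE in H' lastE *; congr cons.
  apply: (IH ((1, z%:Z) :: s)) => //; rewrite ?inE ?eqxx ?Ys ?Os ?orbT //; first by lia.
    by move=> _; rewrite (_ : z%:Z + 1 = z.+1) ?zs ?orbT //; lia.
  by move=> r /predU1P[-> /=|/leY //]; lia.
Qed.

(** Used to merge a step with the run that follows it: a run cannot turn back onto the site just
    left. *)
Lemma ne_prudent_hrun_lt s (x t y : int) p v : ne_prudent s p (hrun x t y ++ v) ->
  (x + 1, y) \in s -> t <= x.
Proof.
case: (leP t x) => // lt_xt; rewrite hrun_lt // => /ne_prudent_mem_notin H /H.
by rewrite inE eqxx.
Qed.

Lemma ne_prudent_hrun_gt s (x t y : int) p v : ne_prudent s p (hrun x t y ++ v) ->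
  (x - 1, y) \in s -> x <= t.
Proof.
case: (leP x t) => // lt_xt; rewrite hrun_gt // => /ne_prudent_mem_notin H /H.
by rewrite inE eqxx.
Qed.

(* A walk that stays in the half-plane x <= 0 cannot step south again: this is *)
(* possible only on the column x = 0, where the origin blocks the way.         *)
Lemma up_rows s (x : int) (y : nat) v : ne_prudent s (x, y%:Z) v ->
  (x, y%:Z) \in s -> (0, 0) \in s -> (x, y%:Z) != (0, 0) -> x <= 0 ->
  {in s, forall r : Z2, r.1 <= 0 /\ r.2 <= y%:Z} ->
  last (x, y%:Z) v = (1, 0) -> exists ks, v = rows_from x y ks.
Proof.
elim: v s x y => [|q v IH] s x y H xs Os nO x0 les lastE.
  by case: lastE; lia.
have [st H'] := ne_prudent_consP H; case: st H' lastE {H} => fr ne H' /= lastE.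
(* East: from x = 0 the walk enters the column x = 1 at a positive height, and the descent is
   forced; otherwise the step extends the run of the current row. *)
- have [xE|x_lt] : x = 0 \/ x + 1 <= 0 by lia.
    have y_gt : (0 < y)%N by case: y nO {H' fr ne les lastE xs} => //; rewrite xE eqxx.
    rewrite xE add0r in H' lastE xs *.
    exists [::]; rewrite rows_from_nil hrun_lt // add0r hrunxx cat_cons cat0s; congr cons.
    apply: (down_column (s := (1, y%:Z) :: s) (Y := y)) => //;
      rewrite ?inE ?eqxx ?xs ?Os ?orbT ?ltxx //.
    by move=> r /predU1P[-> //|/les[]].
  have [||||ks vE] := IH _ _ _ H' _ _ _ x_lt _ lastE; rewrite ?inE ?eqxx ?Os ?orbT //.
  + apply/eqP => -[a b]; have := fr (x + 1) ltac:(lia).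
    by rewrite a b Os.
  + by move=> r /predU1P[-> //|/les].
  exists ks; rewrite vE in H' *.
  case: ks H' {vE} => [|k ks] H' /=; first by rewrite [in RHS]hrun_lt //; lia.
  have := ne_prudent_hrun_gt H'; rewrite addrK inE xs orbT => /(_ isT) ?.
  by rewrite [in RHS]hrun_lt //; lia.
- have [|||||ks vE] := IH _ _ _ H' _ _ _ _ _ lastE; rewrite ?inE ?eqxx ?Os ?orbT //.
  + by apply/eqP => -[]; lia.
  + by lia.
  + by move=> r /predU1P[-> /=|/les//]; lia.
  exists ks; rewrite vE in H' *.
  (* With no row left, the run would go east to the column x = 1, back through (x, y). *)
  case: ks H' {vE} => [|k ks] H' /=.
    by have := ne_prudent_hrun_lt H'; rewrite subrK inE xs orbT => /(_ isT); lia.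
  have := ne_prudent_hrun_lt H'; rewrite subrK inE xs orbT => /(_ isT) ?.
  by rewrite [in RHS]hrun_gt //; lia.
- have yE : y%:Z + 1 = y.+1 by lia.
  rewrite yE in H' lastE *.
  have [||||ks vE] := IH _ _ _ H' _ _ _ x0 _ lastE; rewrite ?inE ?eqxx ?Os ?orbT //.
  + by apply/eqP => -[].
  + by move=> r /predU1P[-> /=|/les]; lia.
  (* A step north closes the row, whose leftmost cell is [x]. *)
  exists (`|x|%N :: ks); have xE : - (`|x|%N)%:Z = x by lia.
  by rewrite vE /= xE hrunxx.
- have /= [|x_ge] := ne_extreme2 ne xs Os; first by lia.
  have xE : x = 0 by lia.
  have y_gt : (0 < y)%N by case: y nO {H' fr ne les lastE xs} => //; rewrite xE eqxx.
  by have := fr 0 ltac:(lia); rewrite xE Os.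
Qed.

(** East and south are excluded by [no_return_right] and [no_return_below]; a step west is below the
    origin and west of the current site. *)
Lemma up_column s (z : nat) v : ne_prudent s (1, - z%:Z) v ->
  (1, - z%:Z) \in s -> (0, 0) \in s -> last (1, - z%:Z) v = (1, 0) ->
  v = run e2 z (1, - z%:Z).
Proof.
elim: v s z => [|q v IH] s z H zs Os lastE.
  by case: z lastE {H zs} => // z [].
case: z H zs lastE => [|z] H zs lastE.
  by have := ne_prudent_last_notin H isT; rewrite lastE zs.
have [st H'] := ne_prudent_consP H; case: st H' lastE {H} => fr ne H' /= lastE.
- move/eqP: lastE => lastE; exfalso; apply/negP: lastE.
  by apply: (no_return_right H'); rewrite ?inE ?eqxx ?Os ?orbT.
- by have /= [] := ne_extreme2 ne Os zs; lia.
- have zE : - z.+1%:Z + 1 = - z%:Z by lia.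
  rewrite pairD addr0 zE in H' lastE *; congr cons.
  by apply: (IH ((1, - z%:Z) :: s)); rewrite ?inE ?eqxx ?Os ?orbT.
- move/eqP: lastE => lastE; exfalso; apply/negP: lastE.
  by apply: (no_return_below H' (t := - z.+1%:Z)); rewrite ?inE ?eqxx ?Os ?zs ?orbT //; lia.
Qed.

(** Below the origin on the column x = 0, the origin blocks north and a step west is not extreme;
    after the step east the ascent is forced. *)
Lemma south_column s (b : nat) v : ne_prudent s (0, - b%:Z) v -> (0 < b)%N ->
  (0, - b%:Z) \in s -> (0, 0) \in s -> last (0, - b%:Z) v = (1, 0) ->
  exists c, v = run (- e2) c (0, - b%:Z) ++
    (1, - (b + c)%N%:Z) :: run e2 (b + c) (1, - (b + c)%N%:Z).
Proof.
elim: v s b => [|q v IH] s b H b0 bs Os lastE; first by case: lastE; lia.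
have [st H'] := ne_prudent_consP H; case: st H' lastE {H} => fr ne H' /= lastE.
- exists 0%N; rewrite addn0 /= add0r; rewrite add0r in H' lastE; congr cons.
  by apply: (up_column (s := (1, - b%:Z) :: s)) => //; rewrite ?inE ?eqxx ?Os ?orbT.
- by have /= [] := ne_extreme2 ne Os bs; lia.
- by have := fr 0 ltac:(lia); rewrite Os.
- have bE : - b%:Z - 1 = - b.+1%:Z by lia.
  rewrite bE in H' lastE *.
  have [|||c vE] := IH _ _ H' _ _ _ lastE; rewrite ?inE ?eqxx ?Os ?orbT //.
  have dE : (0, - b%:Z) + - e2 = (0, - b.+1%:Z) :> Z2 by rewrite pairN pairD bE.
  by exists c.+1; rewrite vE runS dE cat_cons addnS -addSn.
Qed.

Lemma ne_prudent_classify v : ne_prudent [:: 0] 0 v -> (1 < size v)%N -> last 0 v = (1, 0) ->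
  (exists2 b, (0 < b)%N & v = column_walk b) \/
  (exists2 ks, ks != [::] & v = row_walk ks).
Proof.
case: v => // q v H szv lastE.
have O : (0 : Z2) = (0, 0) by [].
rewrite O in H.
have [st H'] := ne_prudent_consP H; case: st H' lastE szv {H} => _ _ H' /= lastE szv.
(* East: the walk is already at (1, 0), and a further step could not bring it back. *)
- case: v szv H' lastE => // r v _ H' lastE.
  by have := ne_prudent_last_notin H' isT; rewrite lastE inE eqxx.
- right; have [|||||ks vE] := up_rows (y := 0) H' _ _ _ _ _ lastE; rewrite ?inE ?eqxx ?orbT //.
    by move=> r; rewrite !inE => /predU1P[->//|/eqP->].
  (* After a step west, an empty list of rows would make the walk run back through the origin. *)
  case: ks vE => [|k ks] vE; rewrite vE in H' *.
    rewrite rows_from_nil in H'.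
    by have := ne_prudent_hrun_lt H'; rewrite !inE => /(_ isT).
  rewrite rows_from_cons in H'; have := ne_prudent_hrun_lt H'; rewrite !inE => /(_ isT) k0.
  by exists (k :: ks) => //; rewrite /row_walk !rows_from_cons [in RHS]hrun_gt //; lia.
- right; have [|||||ks vE] := up_rows (y := 1) H' _ _ _ _ _ lastE; rewrite ?inE ?eqxx ?orbT //.
    by move=> r; rewrite !inE => /predU1P[->//|/eqP->].
  (* After a step north, the lowest row is the single cell 0. *)
  by exists (0%N :: ks); rewrite // /row_walk rows_from_cons hrunxx vE.
- left; have [||c vE] := south_column (b := 1) H' isT _ _ lastE; rewrite ?inE ?eqxx ?orbT //.
  by exists c.+1 => //; rewrite vE.
Qed.

(** * Reflection in the diagonal *)

Definition tr (p : Z2) : Z2 := (p.2, p.1).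

Lemma trK : involutive tr.
Proof. by case. Qed.

Lemma mem_map_tr s p : (tr p \in map tr s) = (p \in s).
Proof. exact/mem_map/inv_inj/trK. Qed.

Lemma trB p q : tr (p - q) = tr p - tr q.
Proof. by []. Qed.

Lemma trDMn p d k : tr (p + d *+ k) = tr p + tr d *+ k.
Proof. by case: p d => [a b] [c d]; rewrite /tr !pairMn. Qed.

Lemma adjacent_tr p q : adjacent (tr p) (tr q) = adjacent p q.
Proof.
rewrite /adjacent -trB; have ->: [:: e1; - e1; e2; - e2] = map tr [:: e2; - e2; e1; - e1] by [].
by rewrite mem_map_tr !inE; do 4!case: (_ == _).
Qed.

Lemma ne_prudent_tr s p v : ne_prudent s p v -> ne_prudent (map tr s) (tr p) (map tr v).
Proof.
elim: v s p => [|q v IH] s p //= [adj fr ne /IH okv]; split=> //.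
- by rewrite adjacent_tr.
- by move=> k k0; rewrite -trB -trDMn mem_map_tr; exact: fr.
- by rewrite /ne_extreme !all_map orbC; exact: ne.
Qed.

Lemma polygonP w : two_sided_prudent_polygon w <->
  [/\ ne_prudent [:: 0] 0 w, (1 < size w)%N & adjacent (endpoint w) 0].
Proof.
split=> [[[pr sz adj] ts]|[okw sz adj]]; first by split=> //; apply/ne_prudentP.
by have [pr ts] := (ne_prudentP w).2 okw; split.
Qed.

Lemma polygon_tr w : two_sided_prudent_polygon w -> two_sided_prudent_polygon (map tr w).
Proof.
move=> /polygonP[okw sz adj]; apply/polygonP; split; rewrite ?size_map //.
  exact: (ne_prudent_tr okw).
by move: adj; rewrite -adjacent_tr /endpoint -(last_map tr w 0).
Qed.

(** * The walks of both families are polygons; excluded endpoints *)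

Lemma mem_run d n p r : r \in run d n p ->
  exists2 k, (0 < k <= n)%N & r = p + d *+ k.
Proof.
elim: n p => // n IH p; rewrite runS inE => /predU1P[->|/IH[k lt_k ->]].
  by exists 1%N; [lia | rewrite mulr1n].
by exists k.+1; [lia | rewrite -addrA -mulrS].
Qed.

Lemma last_run d n p : last p (run d n p) = p + d *+ n.
Proof. by elim: n p => [|n IH] p; rewrite ?addr0 // runS /= IH -addrA -mulrS. Qed.

Lemma mem_hrun x t y r : r \in hrun x t y ->
  [/\ r.2 = y, Num.min x t <= r.1 & r.1 <= Num.max x t].
Proof.
rewrite /hrun /e1; case: leP => le_xt /mem_run[k lt_k ->].
  by rewrite pairMn pairD /= mul0rn addr0; split=> //; lia.
by rewrite pairN pairMn pairD /= oppr0 mul0rn addr0; split=> //; lia.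
Qed.

Lemma last_hrun x t y : last (x, y) (hrun x t y) = (t, y).
Proof.
rewrite /hrun /e1; case: leP => le_xt; rewrite last_run ?pairN pairMn pairD.
  by congr pair; lia.
by congr pair; lia.
Qed.

(** A run that does not go down from a topmost site, or does not go west from a rightmost one, stays
    extreme; this includes horizontal runs along the top row and vertical runs along the east
    side. *)
Lemma ne_prudent_run s p d n : d \in [:: e1; - e1; e2; - e2] -> free_ray s p d ->
  (0 <= d.2 /\ {in s, forall r : Z2, r.2 <= p.2}) \/
  (0 <= d.1 /\ {in s, forall r : Z2, r.1 <= p.1}) ->
  ne_prudent s p (run d n p).
Proof.
move=> du; elim: n s p => // n IH s p fr side; rewrite runS /=.
have dE : p + d - p = d by rewrite addrAC subrr add0r.
split=> //.
- by rewrite /adjacent dE.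
- by rewrite dE.
- rewrite /ne_extreme; case: side => -[d0 H]; apply/orP; [left|right];
    by apply/allP => r /H le_r; rewrite (le_trans le_r) // lerDl.
apply: IH => [k k0|].
  rewrite inE negb_or; apply/andP; split; last by rewrite -addrA -mulrS fr.
  rewrite -subr_eq0 addrAC subrr add0r.
  by move: du; rewrite !inE /e1 /e2 => /or4P[] /eqP ->; rewrite ?pairN pairMn;
    apply/eqP => -[]; lia.
by case: side => -[d0 H]; [left|right]; split=> // r /predU1P[-> //|/H le_r];
  rewrite (le_trans le_r) // lerDl.
Qed.

Lemma ne_prudent_hrun (s : seq Z2) (x t y : int) : {in s, forall r : Z2, r.2 < y \/ r = (x, y)} ->
  ne_prudent s (x, y) (hrun x t y).
Proof.
move=> Hs; have le_y : {in s, forall r : Z2, r.2 <= y}.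
  by move=> r /Hs[|->] //; lia.
rewrite /hrun; case: ifP => _; apply: ne_prudent_run => //.
- move=> k k0; apply/negP => /Hs; rewrite /e1 pairMn pairD => -[/=|[]]; lia.
- by left.
- move=> k k0; apply/negP => /Hs; rewrite /e1 pairN pairMn pairD => -[/=|[]]; lia.
- by left.
Qed.

(** While climbing, each new site is topmost; the final descent is on x = 1, the largest first
    coordinate reached, so its sites are rightmost. *)
Lemma ne_prudent_rows_from s (x : int) (y : nat) ks : x <= 0 ->
  {in s, forall r : Z2, r.1 <= 0 /\ (r.2 < y%:Z \/ r = (x, y%:Z))} ->
  ne_prudent s (x, y%:Z) (rows_from x y ks).
Proof.
elim: ks s x y => [|k ks IH] s x y x0 Hs.
  rewrite rows_from_nil; apply/ne_prudent_cat; split; first by apply: ne_prudent_hrun => r /Hs[].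
  rewrite last_hrun; apply: ne_prudent_run => //.
    move=> n n0; rewrite catrevE mem_cat mem_rev negb_or; apply/andP; split; apply/negP.
      by move/mem_hrun; rewrite /e2 pairN pairMn pairD /= => -[]; lia.
    by move/Hs; rewrite /e2 pairN pairMn pairD /=; lia.
  right; split=> // r; rewrite catrevE mem_cat mem_rev => /orP[/mem_hrun[_ _]|/Hs[]] /=; lia.
rewrite rows_from_cons; apply/ne_prudent_cat; split; first by apply: ne_prudent_hrun => r /Hs[].
have Hs' : {in catrev (hrun x (- k%:Z) y) s, forall r : Z2, r.1 <= 0 /\ r.2 <= y}.
  move=> r; rewrite catrevE mem_cat mem_rev => /orP[/mem_hrun[]|/Hs[r0 [|]]];
    try lia; last by move=> -> /=; lia.
  by move=> -> /=; lia.
rewrite last_hrun /=.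
have dE : (- k%:Z, y.+1%:Z) - (- k%:Z, y%:Z) = e2 :> Z2.
  by rewrite pairN pairD /e2; congr pair; lia.
split.
- by rewrite /adjacent dE.
- by move=> n n0; apply/negP => /Hs'; rewrite dE /e2 pairMn pairD /=; lia.
- by apply/orP; left; apply/allP => r /Hs'[_] /=; lia.
apply: IH; first by lia.
move=> r /predU1P[-> /=|/Hs']; last by lia.
by split; [lia|right].
Qed.

Lemma last_rows_from x y ks : last (x, y%:Z) (rows_from x y ks) = (1, 0).
Proof.
elim: ks x y => [|k ks IH] x y; last by rewrite rows_from_cons last_cat /= IH.
rewrite rows_from_nil last_cat last_hrun last_run /e2 pairN pairMn pairD.
by congr pair; lia.
Qed.

Lemma polygon_row_walk ks : ks != [::] -> two_sided_prudent_polygon (row_walk ks).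
Proof.
move=> nk; apply/polygonP; split.
- apply: ne_prudent_rows_from => // r; rewrite inE => /eqP ->.
  by split; last right.
- case: ks nk => // k ks _; rewrite /row_walk rows_from_cons size_cat /=.
  have := last_rows_from (- k%:Z) 1 ks; case: rows_from => [[] //|p v] _ /=; lia.
- by rewrite /endpoint (last_rows_from 0 0).
Qed.

Lemma last_column_walk b : last 0 (column_walk b) = (1, 0).
Proof.
rewrite /column_walk last_cat /= last_run /e2 pairMn pairD.
by congr pair; lia.
Qed.

Lemma polygon_column_walk b : (0 < b)%N -> two_sided_prudent_polygon (column_walk b).
Proof.
move=> b0; apply/polygonP; split; last by rewrite /endpoint last_column_walk.
- have dE : last 0 (run (- e2) b 0) = (0, - b%:Z).
    by rewrite last_run /e2 pairN pairMn pairD; congr pair; lia.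
  have Hs : {in catrev (run (- e2) b 0) [:: 0], forall r : Z2, r.1 = 0}.
    move=> r; rewrite catrevE mem_cat mem_rev inE => /orP[/mem_run[k _ ->]|/eqP->//].
    by rewrite /e2 pairN pairMn pairD /=; lia.
  apply/ne_prudent_cat; split.
    apply: ne_prudent_run => // [k k0|].
      by rewrite inE /e2 pairN pairMn pairD; apply/eqP => -[]; lia.
    by right; split=> // r; rewrite inE => /eqP->.
  have d1 : (1, - b%:Z) - (0, - b%:Z) = e1 :> Z2 by rewrite pairN pairD subrr.
  rewrite dE /=; split.
  + by rewrite /adjacent d1.
  + by move=> k k0; apply/negP => /Hs; rewrite d1 /e1 pairMn pairD /=; lia.
  + by apply/orP; right; apply/allP => r /Hs -> .
  apply: ne_prudent_run => // [k k0|].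
    rewrite inE /e2 pairMn pairD negb_or; apply/andP; split.
      by apply/eqP => -[]; lia.
    by apply/negP => /Hs /=; lia.
  by right; split=> // r /predU1P[->//|/Hs ->].
- by case: b b0 => // b _; rewrite /column_walk size_cat /=; lia.
Qed.

(** The last step cannot come from (-2, 0), as the origin blocks its ray; nor from the origin, which
    would be revisited; nor from (-1, -1), which is not extreme; nor from (-1, 1), since (-1, 0) is
    then below it and west of the origin. *)
Lemma ne_prudent_last_west w : ne_prudent [:: 0] 0 w -> (1 < size w)%N -> last 0 w <> (-1, 0).
Proof.
case/lastP: w => // w q; case/lastP: w => // w [x y].
rewrite last_rcons -!cats1 -catA => /ne_prudent_cat[okw H] _.
set s := catrev w [:: 0] in H.
have Os : (0, 0) \in s by rewrite /s catrevE mem_cat inE eqxx orbT.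
move: H; rewrite cat_cons cat0s => -[_ fr0 ne1 H].
have xy_notin : (x, y) \notin s.
  by have := fr0 1%N isT; rewrite mulr1n addrC subrK.
have side := ne_extreme2 ne1 Os Os; rewrite /= in side.
have [st _] := @ne_prudent_consP _ _ _ _ [::] H; case: st H => fr ne H [xE yE].
- by have := fr 0 ltac:(lia); rewrite yE inE Os orbT.
- have x0 : x = 0 by lia.
  by move: xy_notin; rewrite x0 yE Os.
- lia.
- have := ne_extreme2 ne (a := (x, y)) (b := (0, 0)).
  by rewrite !inE eqxx Os orbT => /(_ isT isT) [] /=; lia.
Qed.

(** * Undirected edges of runs *)

Definition uedge (p : Z2) (v : seq Z2) (a b : Z2) : bool :=
  ((a, b) \in zip (p :: v) v) || ((b, a) \in zip (p :: v) v).

Lemma uedge_cons p q v a b :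
  uedge p (q :: v) a b = [|| (a, b) == (p, q), (b, a) == (p, q) | uedge q v a b].
Proof. by rewrite /uedge /= !inE -!orbA; congr orb; rewrite orbCA. Qed.

Lemma uedge_nil p a b : uedge p [::] a b = false.
Proof. by []. Qed.

Lemma uedge_cat p u v a b :
  uedge p (u ++ v) a b = uedge p u a b || uedge (last p u) v a b.
Proof.
elim: u p => [|q u IH] p //=.
by rewrite !uedge_cons IH -!orbA.
Qed.

(** The closed curve is opened at the endpoint, so that the closing edge comes first. *)
Lemma is_edgeE w a b : is_edge w a b = uedge (last 0 w) (0 :: w) a b.
Proof.
have aux s x z : zip (x :: s) (rcons s z) = rcons (zip (x :: s) s) (last x s, z) :> seq (Z2 * Z2).
  by elim: s x => //= y s IH x; rewrite IH.
by rewrite /is_edge /oriented_edges rot1_cons aux !mem_rcons /uedge.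
Qed.

Lemma uedge_run_east_h n (x y X Y : int) :
  uedge (x, y) (run e1 n (x, y)) (X, Y) (X + 1, Y) = (Y == y) && (x <= X < x + n%:Z).
Proof.
elim: n x => [|n IH] x; first by rewrite uedge_nil; lia.
by rewrite runS /e1 pairD addr0 uedge_cons IH !xpair_eqE; lia.
Qed.

Lemma uedge_run_west_h n (x y X Y : int) :
  uedge (x, y) (run (- e1) n (x, y)) (X, Y) (X + 1, Y) = (Y == y) && (x - n%:Z <= X < x).
Proof.
elim: n x => [|n IH] x; first by rewrite uedge_nil; lia.
by rewrite runS /e1 pairN pairD oppr0 addr0 uedge_cons IH !xpair_eqE; lia.
Qed.

Lemma uedge_run_east_v n (x y X Y : int) :
  uedge (x, y) (run e1 n (x, y)) (X, Y) (X, Y + 1) = false.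
Proof.
elim: n x => [|n IH] x; first by rewrite uedge_nil; lia.
by rewrite runS /e1 pairD addr0 uedge_cons IH !xpair_eqE; lia.
Qed.

Lemma uedge_run_west_v n (x y X Y : int) :
  uedge (x, y) (run (- e1) n (x, y)) (X, Y) (X, Y + 1) = false.
Proof.
elim: n x => [|n IH] x; first by rewrite uedge_nil; lia.
by rewrite runS /e1 pairN pairD oppr0 addr0 uedge_cons IH !xpair_eqE; lia.
Qed.

Lemma uedge_run_north_v n (x y X Y : int) :
  uedge (x, y) (run e2 n (x, y)) (X, Y) (X, Y + 1) = (X == x) && (y <= Y < y + n%:Z).
Proof.
elim: n y => [|n IH] y; first by rewrite uedge_nil; lia.
by rewrite runS /e2 pairD addr0 uedge_cons IH !xpair_eqE; lia.
Qed.

Lemma uedge_run_south_v n (x y X Y : int) :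
  uedge (x, y) (run (- e2) n (x, y)) (X, Y) (X, Y + 1) = (X == x) && (y - n%:Z <= Y < y).
Proof.
elim: n y => [|n IH] y; first by rewrite uedge_nil; lia.
by rewrite runS /e2 pairN pairD oppr0 addr0 uedge_cons IH !xpair_eqE; lia.
Qed.

Lemma uedge_run_north_h n (x y X Y : int) :
  uedge (x, y) (run e2 n (x, y)) (X, Y) (X + 1, Y) = false.
Proof.
elim: n y => [|n IH] y; first by rewrite uedge_nil; lia.
by rewrite runS /e2 pairD addr0 uedge_cons IH !xpair_eqE; lia.
Qed.

Lemma uedge_run_south_h n (x y X Y : int) :
  uedge (x, y) (run (- e2) n (x, y)) (X, Y) (X + 1, Y) = false.
Proof.
elim: n y => [|n IH] y; first by rewrite uedge_nil; lia.
by rewrite runS /e2 pairN pairD oppr0 addr0 uedge_cons IH !xpair_eqE; lia.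
Qed.

Lemma uedge_hrun_h (x t y X Y : int) :
  uedge (x, y) (hrun x t y) (X, Y) (X + 1, Y) =
  (Y == y) && ((x <= X) != (t <= X)).
Proof.
rewrite /hrun; case: leP => le_xt; rewrite ?uedge_run_east_h ?uedge_run_west_h; lia.
Qed.

Lemma uedge_hrun_v (x t y X Y : int) :
  uedge (x, y) (hrun x t y) (X, Y) (X, Y + 1) = false.
Proof. by rewrite /hrun; case: ifP; rewrite ?uedge_run_east_v ?uedge_run_west_v. Qed.

(** * Enclosed cells and area *)

(* A region whose row y consists of the cells L y, ..., 0, and is empty when   *)
(* L y = 1.                                                                    *)
Definition in_rows (L : int -> int) (c : Z2) : bool := L c.2 <= c.1 < 1.

(* An edge of the polygon separates two adjacent cells exactly when one of     *)
(* them lies in the region and the other does not.                             *)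
Definition bounds_rows (w : seq Z2) (L : int -> int) : Prop := forall x y,
  is_edge w (x, y) (x, y + 1) = (in_rows L (x - 1, y) != in_rows L (x, y)) /\
  is_edge w (x, y) (x + 1, y) = (in_rows L (x, y - 1) != in_rows L (x, y)).

Lemma pass_in_rows w L c d : bounds_rows w L -> pass w c d -> in_rows L c = in_rows L d.
Proof.
move=> bw; case: c => x y; rewrite /pass /e1 /e2 !pairN !pairD !oppr0 !addr0.
case/or4P => /andP[/eqP -> ]; rewrite ?(proj1 (bw _ _)) ?(proj2 (bw _ _)) negbK => /eqP.
- by rewrite addrK.
- by rewrite addrK.
- by move/esym.
- by move/esym.
Qed.

Lemma pass_east w L c : bounds_rows w L -> in_rows L (c + e1) = in_rows L c -> pass w c (c + e1).
Proof.
move=> bw; case: c => x y.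
rewrite /pass eqxx /e1 /e2 !pairN !pairD !oppr0 !addr0 ?(proj1 (bw _ _)) addrK.
by move=> ->; rewrite eqxx.
Qed.

Lemma pass_west w L c : bounds_rows w L -> in_rows L (c - e1) = in_rows L c -> pass w c (c - e1).
Proof.
move=> bw; case: c => x y.
rewrite /pass eqxx /e1 /e2 !pairN !pairD !oppr0 !addr0 ?(proj1 (bw _ _)).
by move=> ->; rewrite eqxx !orbT.
Qed.

Lemma path_run w (d c : Z2) n : (forall k, pass w (c + d *+ k) (c + d *+ k + d)) ->
  path (pass w) c (run d n c).
Proof.
elim: n c => // n IH c H; rewrite runS /=; apply/andP; split.
  by have := H 0%N; rewrite addr0.
by apply: IH => k; rewrite -(addrA c d) -mulrS; exact: H.
Qed.

Lemma enclosed_in_rows w L c : bounds_rows w L -> (forall y, L y <= 1) ->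
  (exists M : int, forall c, in_rows L c -> `|c.1| <= M /\ `|c.2| <= M) ->
  enclosed w c <-> in_rows L c.
Proof.
move=> bw L1 [M HM]; split=> [[N HN]|c_in].
  case: (boolP (in_rows L c)) => // c_out.
  have [c1|c1] := leP 1 c.1.
    (* Enough steps along the row to exceed the supposed bound [N]. *)
    have [|+ _] := HN (run e1 (absz (N - c.1 + 1)%R) c).
      apply: path_run => k; apply: (pass_east bw); move: c1 {c_out}.
      by case: c {HN} => a b; rewrite /e1 pairMn !pairD /in_rows /= ; lia.
    rewrite last_run; move: c1 {c_out HN}.
    by case: c => a b; rewrite /e1 pairMn pairD /=; lia.
  have [|+ _] := HN (run (- e1) (absz (N + c.1 + 1)%R) c).
    apply: path_run => k; apply: (pass_west bw); move: c1 c_out.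
    case: c {HN} => a b; rewrite /e1 pairN pairMn !pairD /in_rows /=.
    by rewrite oppr0 mul0rn !addr0; lia.
  rewrite last_run; move: c1 {c_out HN}.
  by case: c => a b; rewrite /e1 pairN pairMn pairD /=; lia.
exists M => cs; move: c_in; elim: cs c => [|d cs IH] c /= c_in; first by move=> _; apply: HM.
by case/andP => /(pass_in_rows bw) e; apply: IH; rewrite -e.
Qed.

Lemma set_card_seq (T : choiceType) (A : set T) (s : seq T) : uniq s ->
  (forall x, A x <-> x \in s) -> set_card A = size s.
Proof.
move=> us HA; have -> : A = [set` [fset x in s]%fset]%classic.
  by apply/seteqP; split=> x /=; rewrite inE /= => /HA.
by rewrite /set_card set_fsetK card_fseq undup_id.
Qed.

Lemma area_rows w (L : int -> int) (s : seq Z2) : bounds_rows w L ->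
  (forall y, L y <= 1) -> uniq s -> (forall c, (c \in s) = in_rows L c) ->
  area w = size s.
Proof.
move=> bw L1 us sE; apply: set_card_seq => // c.
rewrite sE; apply: enclosed_in_rows => //.
suff [M HM] : exists M : int, forall c, c \in s -> `|c.1| <= M /\ `|c.2| <= M.
  by exists M => d; rewrite -sE; apply: HM.
elim: (s) => [|d s' [M HM]]; first by exists 0.
exists (M + `|M| + `|d.1| + `|d.2|) => e; rewrite inE => /predU1P[-> |/HM].
  by case: d => a b /=; lia.
by case: d e => [a b] [a' b'] /=; lia.
Qed.

(** * Areas of the two families *)

Fixpoint left_end (ks : seq nat) (y : nat) (Y : int) : int :=
  if ks is k :: ks' then
    if Y == y%:Z then - k%:Z else left_end ks' y.+1 Y
  else 1.

Lemma left_end_le1 ks y Y : left_end ks y Y <= 1.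
Proof. by elim: ks y => //= k ks IH y; case: ifP => _ //; lia. Qed.

Lemma left_end_below ks y (Y : int) : Y < y%:Z -> left_end ks y Y = 1.
Proof.
elim: ks y => //= k ks IH y lt_Y; rewrite IH; last by lia.
by case: eqP => // e; lia.
Qed.

Lemma left_end_above ks y (Y : int) : y%:Z + (size ks)%:Z <= Y -> left_end ks y Y = 1.
Proof.
elim: ks y => //= k ks IH y lt_Y; rewrite IH; last by lia.
by case: eqP => // e; lia.
Qed.

Lemma left_end_in ks y (Y : int) : y%:Z <= Y < y%:Z + (size ks)%:Z -> left_end ks y Y <= 0.
Proof.
elim: ks y => [|k ks IH] y /= lt_Y; first by lia.
by case: eqP => e; [lia | apply: IH; lia].
Qed.

(** The first term is the climbs at the left ends; the second is the final descent, which reaches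
    height 0 whatever the starting row [y]. *)
Lemma uedge_rows_from_v ks (x : int) (y : nat) (X Y : int) :
  uedge (x, y%:Z) (rows_from x y ks) (X, Y) (X, Y + 1) =
  (X == left_end ks y Y) && (y%:Z <= Y < y%:Z + (size ks)%:Z) ||
  (X == 1) && (0 <= Y < y%:Z + (size ks)%:Z).
Proof.
elim: ks x y => [|k ks IH] x y.
  rewrite rows_from_nil uedge_cat uedge_hrun_v last_hrun uedge_run_south_v /=; lia.
rewrite rows_from_cons uedge_cat uedge_hrun_v last_hrun uedge_cons IH /= !xpair_eqE.
by have [e|ne] := eqVneq Y y%:Z; lia.
Qed.

(** The run at height [Y] joins the left ends of the rows below and above it, the lowest run
    starting at [x]. Above the last row [left_end] is 1, the column of the descent. *)
Lemma uedge_rows_from_h ks (x : int) (y : nat) (X Y : int) :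
  uedge (x, y%:Z) (rows_from x y ks) (X, Y) (X + 1, Y) =
  (Y == y%:Z) && ((x <= X) != (left_end ks y Y <= X)) ||
  (y%:Z < Y) && ((left_end ks y (Y - 1) <= X) != (left_end ks y Y <= X)).
Proof.
elim: ks x y => [|k ks IH] x y.
  rewrite rows_from_nil uedge_cat uedge_hrun_h last_hrun uedge_run_south_h /=; lia.
rewrite rows_from_cons uedge_cat uedge_hrun_h last_hrun uedge_cons IH /= !xpair_eqE.
have [e|ne] := eqVneq Y y%:Z; first by rewrite e; lia.
have [e|ne'] := eqVneq (Y - 1) y%:Z; last by lia.
lia.
Qed.

Fixpoint cells (ks : seq nat) (y : nat) : seq Z2 :=
  if ks is k :: ks' then
    [seq (- i%:Z, y%:Z) | i <- iota 0 k.+1] ++ cells ks' y.+1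
  else [::].

Lemma mem_cells ks y c : (c \in cells ks y) = in_rows (left_end ks y) c.
Proof.
case: c => X Y; rewrite /in_rows /=; elim: ks y => [|k ks IH] y; first by rewrite in_nil /=; lia.
rewrite /cells -/cells mem_cat IH /=.
have -> : ((X, Y) \in [seq (- i%:Z, y%:Z) | i <- iota 0 k.+1]) =
    (Y == y%:Z) && (- k%:Z <= X < 1).
  apply/idP/idP => [/mapP[i]|/andP[/eqP-> Xk]].
    by rewrite mem_iota => lt_i [-> ->]; lia.
  by apply/mapP; exists `|X|%N; [rewrite mem_iota; lia | congr pair; lia].
case: eqP => // ->; rewrite left_end_below; lia.
Qed.

Lemma uniq_cells ks y : uniq (cells ks y).
Proof.
elim: ks y => // k ks IH y; rewrite /cells -/cells cat_uniq IH andbT.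
rewrite map_inj_uniq ?iota_uniq ?andTb; last by move=> i j []; lia.
apply/hasPn => -[X Y]; rewrite mem_cells /in_rows => Hc.
apply/negP => /mapP[i _ [_ YE]].
by move: Hc; rewrite /= YE left_end_below; lia.
Qed.

Definition total (ks : seq nat) : nat := sumn (map S ks).

Lemma size_cells ks y : size (cells ks y) = total ks.
Proof.
by elim: ks y => // k ks IH y; rewrite /cells -/cells size_cat size_map size_iota IH.
Qed.

(* Adding the closing edge from (1, 0) turns the first run of row_walk into    *)
(* one that starts at (1, 0) instead of (0, 0).                                *)
Lemma sites_row_walk k ks : sites (row_walk (k :: ks)) = rows_from 1 0 (k :: ks).
Proof.
rewrite /row_walk !rows_from_cons [in RHS]hrun_gt; last by lia.
by [].
Qed.

Lemma area_row_walk ks : ks != [::] -> area (row_walk ks) = total ks.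
Proof.
move=> nk; rewrite -(size_cells ks 0).
have eE a b : is_edge (row_walk ks) a b = uedge (1, 0%N%:Z) (rows_from 1 0 ks) a b.
  rewrite is_edgeE (last_rows_from 0 0); case: ks nk => // k ks _.
  by rewrite -sites_row_walk.
apply: (area_rows (L := left_end ks 0)).
- move=> x y; rewrite !eE uedge_rows_from_v uedge_rows_from_h /in_rows /=; split.
    have := @left_end_in ks 0 y; have := @left_end_above ks 0 y.
    have := @left_end_below ks 0 y; lia.
  have := left_end_le1 ks 0 (y - 1); have := left_end_le1 ks 0 y.
  have := @left_end_below ks 0 y; have := @left_end_below ks 0 (y - 1); lia.
- by move=> y; apply: left_end_le1.
- exact: uniq_cells.
- exact: mem_cells.
Qed.

Lemma area_column_walk b : (0 < b)%N -> area (column_walk b) = b.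
Proof.
move=> b0.
have eE X Y : is_edge (column_walk b) X Y =
    uedge (1, 0) (0 :: column_walk b) X Y by rewrite is_edgeE last_column_walk.
have dE : last 0 (run (- e2) b 0) = (0, - b%:Z).
  by rewrite last_run /e2 pairN pairMn pairD; congr pair; lia.
(* The cells of column 0 with -b <= y < 0; the left end 1 makes every other row empty. *)
rewrite (@area_rows _ (fun y => if - b%:Z <= y < 0 then 0 else 1)
  [seq (0, - k.+1%:Z) | k <- iota 0 b]).
- by rewrite size_map size_iota.
- move=> x y; rewrite !eE !uedge_cons !uedge_cat dE !uedge_cons.
  rewrite (uedge_run_south_v b 0 0) uedge_run_north_v (uedge_run_south_h b 0 0) uedge_run_north_h.
  rewrite !xpair_eqE /in_rows /=; split; first by case: ifP; lia.
  by case: ifP; case: ifP; lia.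
- by move=> y; case: ifP.
- by rewrite map_inj_uniq ?iota_uniq // => i j []; lia.
- move=> [X Y]; rewrite /in_rows /=; apply/idP/idP => [/mapP[i]|H].
    by rewrite mem_iota => lt_i [-> ->]; case: ifP; lia.
  apply/mapP; exists (absz Y).-1; first by rewrite mem_iota; move: H; case: ifP; lia.
  by move: H; case: ifP => H1 H; congr pair; lia.
Qed.

(** * Reflection preserves the area *)

Lemma is_edge_tr w a b : is_edge (map tr w) (tr a) (tr b) = is_edge w a b.
Proof.
pose tr2 (e : Z2 * Z2) := (tr e.1, tr e.2).
have tr2K : involutive tr2 by move=> [[? ?] [? ?]].
have -> : is_edge (map tr w) (tr a) (tr b) =
    (tr2 (a, b) \in oriented_edges (map tr w)) ||
    (tr2 (b, a) \in oriented_edges (map tr w)) by [].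
have -> : oriented_edges (map tr w) = map tr2 (oriented_edges w).
  rewrite /oriented_edges (_ : sites _ = map tr (sites w)) // -map_rot.
  by elim: (sites w) (rot 1 _) => [|p s IH] [|q s'] //=; rewrite IH.
by rewrite !mem_map //; apply: inv_inj.
Qed.

Lemma pass_tr w c d : pass (map tr w) (tr c) (tr d) = pass w c d.
Proof.
case: c d => [x y] [x' y']; rewrite /pass /e1 /e2 /tr !pairN !pairD !oppr0 !addr0.
have E p q p' q' : is_edge (map tr w) (p, q) (p', q') = is_edge w (q, p) (q', p').
  exact: (is_edge_tr w (q, p) (q', p')).
rewrite !E !xpair_eqE.
rewrite ![(y' == _) && _]andbC.
by rewrite orbCA; congr [|| _, _ | _]; rewrite orbC.
Qed.

Lemma enclosed_tr w c : enclosed w c -> enclosed (map tr w) (tr c).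
Proof.
case=> M HM; exists M => cs.
have -> : cs = map tr (map tr cs) by rewrite mapK //; exact: trK.
rewrite (last_map tr) path_map /relpre /=.
by rewrite (eq_path (pass_tr w)) => /HM[].
Qed.

Lemma set_card_image_inv (T : choiceType) (f : T -> T) (A : set T) :
  involutive f -> set_card [set f x | x in A]%classic = set_card A.
Proof.
move=> fK; rewrite /set_card; have [fA|nfA] := pselect (finite_set A).
  rewrite fset_set_image // card_imfset //; exact: inv_inj.
(* On infinite sets [set_card] is 0, and the image is then infinite too. *)
have nfB : ~ finite_set [set f x | x in A]%classic.
  move=> fB; apply: nfA; have := finite_image f fB.
  by rewrite image_comp (_ : f \o f = id) ?image_id //; apply/funext => x; exact: fK.
by rewrite /fset_set; case: pselect => // ?; case: pselect.
Qed.

Lemma area_tr w : area (map tr w) = area w.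
Proof.
rewrite /area -(set_card_image_inv _ trK); congr set_card.
apply/seteqP; split=> [_ [c Hc <-]|c Hc] /=.
  by have := enclosed_tr Hc; rewrite mapK //; exact: trK.
by exists (tr c); [exact: enclosed_tr | exact: trK].
Qed.

(** * Enumeration by compositions *)

(** The first site off row [y] is (-k, y + 1), which determines [k] and the rest of the walk; an
    empty list is recognised by a walk that never leaves the row upwards. *)
Lemma row_walk_inj : injective row_walk.
Proof.
have row_last (ks : seq nat) (x : int) (y : nat) k :
    rows_from x y (k :: ks) <> rows_from x y [::].
  move=> e; have : (- k%:Z, y.+1%:Z) \in rows_from x y [::].
    by rewrite -e rows_from_cons mem_cat inE eqxx orbT.
  rewrite rows_from_nil mem_cat => /orP[/mem_hrun[/=]|/mem_run[n _]]; first lia.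
  by rewrite /e2 pairN pairMn pairD => -[]; lia.
have cut (u1 u2 v1 v2 : seq Z2) a1 a2 (y : int) : a1.2 != y -> a2.2 != y ->
    {in u1, forall p, p.2 = y} -> {in u2, forall p, p.2 = y} ->
    u1 ++ a1 :: v1 = u2 ++ a2 :: v2 -> a1 = a2 /\ v1 = v2.
  move=> h1 h2; elim: u1 u2 => [|p u1 IH] [|p' u2] Hu1 Hu2 /=.
  - by case.
  - by case=> e; have := Hu2 _ (mem_head _ _); rewrite -e => /eqP; rewrite (negbTE h1).
  - by case=> e; have := Hu1 _ (mem_head _ _); rewrite e => /eqP; rewrite (negbTE h2).
  - case=> _; apply: IH => r ru; [apply: Hu1 | apply: Hu2]; by rewrite inE ru orbT.
suff H ks ks' x y : rows_from x y ks = rows_from x y ks' -> ks = ks' by move=> ks ks'; exact: H.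
elim: ks ks' x y => [|k ks IH] [|k' ks'] x y //.
- by move/esym/row_last.
- by move/row_last.
rewrite !rows_from_cons => /(cut _ _ _ _ _ _ y%:Z)[||||[kk] /[dup] e].
- by apply/eqP => /=; lia.
- by apply/eqP => /=; lia.
- by move=> p /mem_hrun[].
- by move=> p /mem_hrun[].
have -> : k' = k by lia.
by move: e; rewrite kk => e /IH ->.
Qed.

Definition grow (ks : seq nat) : seq nat :=
  if ks is k :: ks' then k.+1 :: ks' else [::].

(* A composition of m + 1 is represented by the list of its parts minus 1.     *)
Fixpoint compositions (m : nat) : seq (seq nat) :=
  if m is m'.+1 then map (cons 0%N) (compositions m') ++ map grow (compositions m')
  else [:: [:: 0%N]].

(** A composition of m + 2 has first part 1 followed by a composition of m + 1, or has a larger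
    first part and comes from one of m + 1 by [grow]. *)
Lemma mem_compositions m ks : (ks \in compositions m) = (ks != [::]) && (total ks == m.+1).
Proof.
have total0 ks' : (total ks' == 0%N) = (ks' == [::]) by case: ks'.
have cons0 (k : nat) ks' : (k :: ks' != [::]) = true by [].
have totalS (k : nat) ks' : total (k :: ks') = (k.+1 + total ks')%N by [].
elim: m ks => [|m IH] ks.
  rewrite inE; case: ks => // k ks; rewrite eqseq_cons -(total0 ks) totalS cons0; lia.
rewrite [compositions _]/= mem_cat; case: ks => [|k ks].
  by apply/orP => -[/mapP[]//|/mapP[[|k ks]]//]; rewrite IH.
case: k => [|k].
  rewrite orbC (introF mapP) ?orFb; last by case=> -[|k' ks'] //; rewrite IH.
  by rewrite mem_map => [|? ? []//]; rewrite IH -(total0 ks) totalS cons0; lia.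
rewrite (introF mapP) ?orFb; last by case.
have -> : (k.+1 :: ks \in map grow (compositions m)) = (k :: ks \in compositions m).
  apply/mapP/idP => [[[|k' ks'] // H [-> ->]] //|H].
  by exists (k :: ks).
by rewrite IH !totalS !cons0; lia.
Qed.

Lemma uniq_compositions m : uniq (compositions m).
Proof.
elim: m => // m IH; rewrite [compositions _]/= cat_uniq !map_inj_in_uniq ?IH ?andbT /=.
- apply/hasPn => ks /mapP[[|k ks'] _ ->] /=; by apply/mapP => -[].
- by move=> [|k ks] [|k' ks'] //; rewrite !mem_compositions //= => _ _ [-> ->].
- by move=> ? ? _ _ [].
Qed.

Lemma size_compositions m : size (compositions m) = (2 ^ m)%N.
Proof. by elim: m => // m IH; rewrite [compositions _]/= size_cat !size_map IH expnS; lia. Qed.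

Definition east_polygons (n : nat) : seq (seq Z2) :=
  column_walk n :: map row_walk (compositions n.-1).

Lemma mem_east_polygons n w : (0 < n)%N -> w \in east_polygons n <->
  [/\ two_sided_prudent_polygon w, endpoint w = (1, 0) & area w = n].
Proof.
move=> n0; rewrite inE; split=> [/predU1P[->|/mapP[ks]]|[Pw ew aw]].
- split; [exact: polygon_column_walk | exact: last_column_walk | exact: area_column_walk].
- rewrite mem_compositions => /andP[nk /eqP tk ->]; split.
  + exact: polygon_row_walk.
  + exact: (last_rows_from 0 0).
  + by rewrite area_row_walk // tk prednK.
have /polygonP[okw sz _] := Pw.
have [[b b0 wE]|[ks nk wE]] := ne_prudent_classify okw sz ew; move: aw; rewrite wE.
  by rewrite area_column_walk // => ->; rewrite eqxx.
rewrite area_row_walk // => tk; apply/orP; right; apply: map_f.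
by rewrite mem_compositions nk tk prednK // eqxx.
Qed.

Lemma rows_from_above x y ks r : r \in rows_from x y ks -> 0 <= r.2.
Proof.
elim: ks x y => [|k ks IH] x y; rewrite ?rows_from_nil ?rows_from_cons mem_cat.
  case/orP => [/mem_hrun[-> //]|/mem_run[n lt_n ->]].
  by rewrite /e2 pairN pairMn pairD /=; lia.
by rewrite inE => /or3P[/mem_hrun[-> //]|/eqP->|/IH].
Qed.

Lemma uniq_east_polygons n : (0 < n)%N -> uniq (east_polygons n).
Proof.
move=> n0; rewrite /= map_inj_uniq ?uniq_compositions ?andbT; last exact: row_walk_inj.
apply/mapP => -[ks _ e].
have /rows_from_above : (0, -1) \in row_walk ks.
  by rewrite -e; case: (n) n0 => // m _; rewrite /column_walk runS /= inE eqxx.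
by [].
Qed.

Definition area_polygons (n : nat) : seq (seq Z2) :=
  east_polygons n ++ map (map tr) (east_polygons n).

Lemma mapK_tr : involutive (map tr).
Proof. by move=> w; rewrite mapK //; exact: trK. Qed.

Lemma endpoint_tr w : endpoint (map tr w) = tr (endpoint w).
Proof. exact: (last_map tr w 0). Qed.

Lemma mem_area_polygons n w : (0 < n)%N ->
  (two_sided_prudent_polygon w /\ area w = n) <-> w \in area_polygons n.
Proof.
move=> n0; rewrite mem_cat; split; last first.
  case/orP => [/(mem_east_polygons _ n0)[] //|/mapP[v /(mem_east_polygons _ n0)[Pv _ av] ->]].
  by split; [exact: polygon_tr | rewrite area_tr].
move=> [Pw aw]; have /polygonP[okw sz adj] := Pw.
have Ptw := polygon_tr Pw; have /polygonP[oktw sztw _] := Ptw.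
have et := endpoint_tr w.
have -> : (w \in map (map tr) (east_polygons n)) = (map tr w \in east_polygons n).
  by rewrite -[w in LHS]mapK_tr mem_map //; exact/inv_inj/mapK_tr.
(* These exclude the endpoint (-1, 0) and, through the reflected walk, (0, -1). *)
have nW := ne_prudent_last_west okw sz; have nWt := ne_prudent_last_west oktw sztw.
rewrite -/(endpoint _) et in nWt; rewrite -/(endpoint _) in nW.
case ew: (endpoint w) adj nW nWt et => [a b].
rewrite /adjacent /e1 /e2 /tr /= => adj nW nWt et.
rewrite !inE sub0r !pairN !xpair_eqE in adj.
have [[aE bE]|[aE bE]] : (a = 1 /\ b = 0) \/ (a = 0 /\ b = 1).
  case/or4P: adj => /andP[/eqP ea /eqP eb]; try lia.
  - by case: nW; congr pair; lia.
  - by case: nWt; congr pair; lia.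
- by apply/orP; left; apply/(mem_east_polygons _ n0); rewrite ew aE bE.
- by apply/orP; right; apply/(mem_east_polygons _ n0); rewrite et aE bE area_tr.
Qed.

Lemma uniq_area_polygons n : (0 < n)%N -> uniq (area_polygons n).
Proof.
move=> n0; rewrite cat_uniq map_inj_uniq; last exact/inv_inj/mapK_tr.
rewrite uniq_east_polygons // andbT andTb; apply/hasPn => w /mapP[v].
case/(mem_east_polygons _ n0) => _ ev _ ->; apply/negP.
by case/(mem_east_polygons _ n0) => _; rewrite endpoint_tr ev.
Qed.

Lemma PA2_eq n : (1 <= n)%N -> PA2 n = (2 ^ n + 2)%N.
Proof.
move=> n0; rewrite /PA2 (@set_card_seq _ _ (area_polygons n)).
- rewrite size_cat size_map /= size_map size_compositions.
  by case: n n0 => // n _; rewrite expnS /=; lia.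
- exact: uniq_area_polygons.
- by move=> w; exact: mem_area_polygons.
Qed.

(** * The generating function *)

Lemma fps_mulX (R : comNzRingType) (f : fps R) n :
  (f * fpsX R) n = if n is m.+1 then f m else 0.
Proof.
change (fps_mul f (fpsX R) n = if n is m.+1 then f m else 0).
rewrite /fps_mul /fpsX; case: n => [|n]; first by rewrite big_ord1 mulr0.
rewrite !big_ord_recr /= subnn mulr0 addr0 subSnn mulr1 big1 ?add0r // => i _.
have -> : (n.+1 - i == 1)%N = false by have := ltn_ord i; lia.
by rewrite mulr0.
Qed.

Lemma fpsD (R : comNzRingType) (f g : fps R) n : (f + g) n = f n + g n.
Proof. by []. Qed.

Lemma fpsN (R : comNzRingType) (f : fps R) n : (- f) n = - f n.
Proof. by []. Qed.

Lemma fps_divE (f g h : fps rat) : h 0%N = 1 -> f * h = g -> g / h = f.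
Proof.
move=> h0 <-; rewrite mulrK //.
by change (h 0%N \is a GRing.unit); rewrite h0 unitr1.
Qed.

Theorem proposition1 :
  (let q : fps rat := fpsX rat in
   area_gf = 2 * q / (1 - 2 * q) + 2 * q / (1 - q))
  /\ (forall n : nat, (1 <= n)%N -> PA2 n = (2 ^ n + 2)%N).
Proof.
split; last exact: PA2_eq.
move=> q.
have q0 : q 0%N = 0 by [].
have one0 : (1 : fps rat) 0%N = 1 by [].
(* The first quotient has coefficients 2^n for n >= 1 and 0 at n = 0, checked by multiplying back;
   the second is treated likewise with the constant 2. *)
rewrite (@fps_divE (fun n => if n is m.+1 then 2 ^+ n else 0)); first last.
- apply/funext => n; rewrite mulrBr mulr1 mulrA [_ * 2]mulr_natr mulr2n mulrDl.
  rewrite mulr_natl mulr2n !fpsD fpsN fpsD !fps_mulX.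
  case: n => [|[|n]]; rewrite /q /fpsX /=.
  + by [].
  + by rewrite ?addr0 ?subr0 ?oppr0 ?addr0.
  + by rewrite [2 ^+ n.+2]exprS mulr_natl mulr2n subrr addr0.
- by rewrite mulr_natl mulr2n fpsD fpsN fpsD q0 one0 !addr0.
rewrite (@fps_divE (fun n => if n is m.+1 then 2 else 0)); first last.
- apply/funext => n; rewrite mulrBr mulr1 mulr_natl mulr2n !fpsD fpsN !fps_mulX.
  by case: n => [|[|n]]; rewrite /q /fpsX /= ?subr0 ?subrr ?addr0.
- by rewrite fpsD fpsN q0 one0 subr0.
apply/funext => -[|n]; first by rewrite fpsD addr0.
by rewrite fpsD /area_gf /= PA2_eq // natrD natrX.
Qed.
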